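(* Let $L$ be the union of $s$ pairwise disjoint linear subspaces of dimension $r$ in $\mathbb{P}^n$, and let $I\subset\mathbb{K}[\mathbb{P}^n]$ be the ideal of $L$. Then $$\operatorname{aHP}_I(t)=\frac{t^n}{n!}-\Lambda_{n,r,s}(t).$$
   Context: $\mathbb{K}$ is an algebraically closed field of characteristic zero, and $\mathbb{K}[\mathbb{P}^n]=\mathbb{K}[x_1,\dots,x_{n+1}]$ with the standard grading. The $m$-th symbolic power of a homogeneous radical ideal $I$ is $I^{(m)}=\mathbb{K}[\mathbb{P}^n]\cap\bigcap_{Q\in\operatorname{Ass}(I)}(I^m)_Q$, where the localizations are embedded in the field of fractions of $\mathbb{K}[\mathbb{P}^n]$. For a homogeneous ideal $J$, $\operatorname{HP}_J$ is the Hilbert polynomial, i.e. the polynomial agreeing with $\dim_{\mathbb{K}}(\mathbb{K}[\mathbb{P}^n]_t/J_t)$ for $t\gg0$. The asymptotic Hilbert polynomial of $I$ is $$\operatorname{aHP}_I(t)=\lim_{m\to\infty}\frac{\operatorname{HP}_{I^{(m)}}(mt)}{m^n}.$$ For $I$ the ideal of $s$ pairwise disjoint $r$-dimensional linear subspaces of $\mathbb{P}^n$, put $$P_{n,r,s,m}(t)=\binom{t+n}{n}-\operatorname{HP}_{I^{(m)}}(t).$$ Substituting $mt$ for $t$, the expression $P_{n,r,s,m}(mt)$ is a polynomial in $m$ (with coefficients that are polynomials in $t$); $\Lambda_{n,r,s}(t)$ denotes its leading coefficient as a polynomial in $m$. *)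

(* Defs.v *)
From HB Require Import structures.
From mathcomp Require Import all_boot all_order all_algebra fraction.
From mathcomp Require Import mpoly. (* before analysis: notation levels clash otherwise *)
From mathcomp Require Import boolp classical_sets reals topology normedtype sequences.
Set Implicit Arguments.
Unset Strict Implicit.
Unset Printing Implicit Defensive.
Import Order.TTheory GRing.Theory Num.Theory.
Import numFieldNormedType.Exports.

Local Open Scope classical_set_scope.
Local Open Scope ring_scope.

Section Ideals.
Variable A : idomainType.
Implicit Types I J Q : set A.

Definition is_ideal I :=
  [/\ I 0, forall a b, I a -> I b -> I (a + b) & forall a b, I b -> I (a * b)].

Definition is_prime_ideal Q :=
  [/\ is_ideal Q, ~ Q 1 & forall a b, Q (a * b) -> Q a \/ Q b].

Definition ideal_gen (S : set A) : set A := smallest is_ideal S.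

Definition ideal_pow I (m : nat) : set A :=
  ideal_gen [set a | exists2 f : 'I_m -> A,
    (forall i, I (f i)) & a = \prod_(i < m) f i].

(* Q is in Ass(I) when Q is a prime of the form (I : a), i.e. the annihilator
   of the class of a in A / I. *)
Definition associated_prime I Q :=
  is_prime_ideal Q /\ exists a, Q = [set b | I (b * a)].

Definition localization J Q : set {fraction A} :=
  [set x | exists a b, [/\ J a, ~ Q b & x = tofrac a / tofrac b]].

Definition symbolic_power I (m : nat) : set A :=
  [set f | forall Q, associated_prime I Q ->
             localization (ideal_pow I m) Q (tofrac f)].

End Ideals.

Section Projective.
Variables (K : closedFieldType) (n : nat).

(* Homogeneous coordinate vectors of the points of P(V).  A subset of P^n is
   represented by the set of all homogeneous coordinate vectors of its points;
   P(V) has projective dimension \dim V - 1. *)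
Definition proj_space (V : {vspace 'rV[K]_n.+1}) : set 'rV[K]_n.+1 :=
  [set v | v != 0 /\ v \in V].

Definition vanishing_ideal (L : set 'rV[K]_n.+1) : set {mpoly K[n.+1]} :=
  [set f | forall v, L v -> f.@[v 0] = 0].

Definition disjoint_subspaces (r s : nat) (V : 'I_s -> {vspace 'rV[K]_n.+1}) :=
  (forall i, \dim (V i) = r.+1) /\ trivIset setT (fun i => proj_space (V i)).

Definition subspaces_ideal (s : nat) (V : 'I_s -> {vspace 'rV[K]_n.+1}) :=
  vanishing_ideal (\bigcup_(i in [set: 'I_s]) proj_space (V i)).

End Projective.

Section Hilbert.
Variables (K : closedFieldType) (n : nat).
Implicit Types J : set {mpoly K[n.+1]}.

(* J_t as a subspace of the space of forms of degree t. *)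
Definition graded_piece J (t : nat) : {vspace dhomog n.+1 K t} :=
  xget 0%VS [set W : {vspace dhomog n.+1 K t} |
    forall f : dhomog n.+1 K t, (f \in W) <-> J (f : {mpoly K[n.+1]})].

(* dim (K[P^n]_t / J_t), as a codimension. *)
Definition hilbert_fun J (t : nat) : nat :=
  (\dim {: dhomog n.+1 K t} - \dim (graded_piece J t))%N.

Definition is_hilbert_poly J (p : {poly rat}) :=
  exists N : nat, forall t : nat, (N <= t)%N ->
    p.[t%:R] = (hilbert_fun J t)%:R.

Definition hilbert_poly J : {poly rat} := xget 0 (is_hilbert_poly J).

Definition aHP_seq (R : realType) (I : set {mpoly K[n.+1]}) (t : R) : R^nat :=
  fun m => (map_poly ratr (hilbert_poly (symbolic_power I m))).[m%:R * t]
             / m%:R ^+ n.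

Definition aHP (R : realType) (I : set {mpoly K[n.+1]}) (t : R) : R :=
  limn (aHP_seq I t).

(* binom(t + n, n) as a polynomial in t. *)
Definition binomial_poly : {poly rat} :=
  (n`!%:R)^-1 *: \prod_(i < n) ('X + (i.+1%:R)%:P).

Definition P_poly (I : set {mpoly K[n.+1]}) (m : nat) : {poly rat} :=
  binomial_poly - hilbert_poly (symbolic_power I m).

(* Q is P_{n,r,s,m}(mt) seen as a polynomial in m over Q[t].  The value m = 0 is
   excluded: I^(0) is the unit ideal, and for r = n the value at m = 0 does not
   fit the polynomial valid for m >= 1. *)
Definition P_in_m (I : set {mpoly K[n.+1]}) (Q : {poly {poly rat}}) :=
  forall m : nat, (0 < m)%N -> Q.[m%:R] = P_poly I m \Po (m%:R *: 'X).

End Hilbert.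

(* P_{n,r,s,m} depends only on n, r, s and m, so its leading coefficient in m is
   the same for all configurations of s pairwise disjoint r-dimensional
   subspaces of P^n. *)
Definition is_Lambda (K : closedFieldType) (n r s : nat) (l : {poly rat}) :=
  forall V : 'I_s -> {vspace 'rV[K]_n.+1}, disjoint_subspaces r V ->
    exists2 Q, P_in_m (subspaces_ideal V) Q & lead_coef Q = l.

Definition Lambda (K : closedFieldType) (n r s : nat) : {poly rat} :=
  xget 0 (is_Lambda K n r s).

(* Main.v *)
(* Let Q_i be the prime ideal of the i-th subspace and c = n - r.  In coordinates
   adapted to the subspace, Q_i^m consists of the polynomials all of whose monomials
   have degree >= m in c of the variables; in particular Q_i^m is Q_i-primary, so
   I^(m) is the intersection of the Q_i^m.  Since the subspaces are disjoint, every
   variable lies in Q_i + Q_j for i <> j, so the powers Q_i^m are comaximal in large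
   degrees and the Hilbert functions of the Q_i^m add up.  Sorting the monomials of
   degree t >= m with degree < m in the first c variables by the variable at which
   the partial degree reaches m counts them as
     \sum_(k <= r) 'C(m-1+n-k, n-k) * 'C(t-m+k, k).
   After t := m t this is a polynomial in m of degree at most n, whose coefficient of
   m^n has degree at most r in t.  If r < n this cannot cancel the term t^n/n! of
   binom(mt+n, n), so Lambda is the coefficient of m^n in P(mt); if r = n there is at
   most one subspace, and for s = 1 both P and its coefficient of m^n vanish. *)
Require Import Defs.
From HB Require Import structures.
From mathcomp Require Import all_boot all_order all_algebra fraction.
From mathcomp Require Import zify ring.
From mathcomp Require Import mpoly.
From mathcomp Require Import boolp classical_sets reals topology normedtype sequences.
Set Implicit Arguments.
Unset Strict Implicit.
Unset Printing Implicit Defensive.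
Import Order.TTheory GRing.Theory Num.Theory.
Import numFieldNormedType.Exports.

(** * Counting monomials *)

(** Exponent vectors of the monomials of degree [t] in [k] variables. The recursion separates a zero
    first exponent from a positive one, so that Pascal's rule can be read off it. *)
Fixpoint comps (k : nat) : nat -> seq (seq nat) :=
  match k with
  | 0 => fun t => if t is 0 then [:: [::]] else [::]
  | k'.+1 => fix aux t :=
      match t with
      | 0 => [seq 0 :: l | l <- comps k' 0]
      | t'.+1 => [seq 0 :: l | l <- comps k' t] ++ [seq incr_nth l 0 | l <- aux t']
      end
  end.

Lemma compsS0 k : comps k.+1 0 = [seq 0 :: l | l <- comps k 0].
Proof. by []. Qed.

Lemma compsSS k t :
  comps k.+1 t.+1 = [seq 0 :: l | l <- comps k t.+1]
    ++ [seq incr_nth l 0 | l <- comps k.+1 t].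
Proof. by []. Qed.

Lemma mem_comps k t l : (l \in comps k t) = (size l == k) && (sumn l == t).
Proof.
have inj0 : injective (cons 0) by move=> u v [].
elim: k t l => [|k IHk] t l; first by case: t => [|t]; case: l => [|x l].
elim: t l => [|t IHt] l.
  case: l => [|[|x] l] /=.
  - by apply/negbTE/negP => /mapP[].
  - by rewrite mem_map // IHk eqSS add0n.
  - by rewrite addSn andbF; apply/negbTE/negP => /mapP[? _ []].
rewrite compsSS mem_cat.
case: l => [|[|x] l].
- apply/negbTE/negP => /orP[] /mapP[] // y.
  by case: y.
- rewrite mem_map // IHk /= eqSS add0n.
  rewrite [X in _ || X](_ : _ = false) ?orbF //.
  by apply/negbTE/negP => /mapP[[|y v] _ []].
- rewrite [X in X || _](_ : _ = false) /=; last by apply/negbTE/negP => /mapP[? _ []].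
  have -> : x.+1 :: l = incr_nth (x :: l) 0 by [].
  apply/mapP/idP => [[[|y v] yv [-> ->]]|h].
  + by move: yv; rewrite IHt.
  + by move: yv; rewrite IHt.
  + by exists (x :: l); rewrite ?IHt.
Qed.

Lemma comps_uniq k t : uniq (comps k t).
Proof.
elim: k t => [|k IHk] t; first by case: t.
elim: t => [|t IHt]; first by rewrite map_inj_uniq // => u v [].
rewrite compsSS cat_uniq map_inj_uniq ?IHk; last by move=> u v [].
rewrite map_inj_in_uniq ?IHt ?andbT; last first.
  by move=> [|x u] [|y v]; rewrite !mem_comps // => _ _ [-> ->].
apply/hasPn => v /mapP[[|x u] hu ->]; apply/negP => /mapP[] // w _ [].
Qed.

(** Exponents of the monomials of degree [t] outside the [m]-th power of the ideal of the first [c]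
    variables. *)
Definition low_comps c m k t : seq (seq nat) :=
  [seq l <- comps k t | sumn (take c l) < m].

Lemma size_comps r t : size (comps r.+1 t) = 'C(t + r, r).
Proof.
elim: r t => [|r IHr] t.
  by rewrite bin0; elim: t => [//|t IHt]; rewrite compsSS size_cat !size_map IHt.
elim: t => [|t IHt]; first by rewrite compsS0 size_map IHr !add0n !binn.
by rewrite compsSS size_cat !size_map IHr IHt [in RHS]addSn binS addnC addSnnS.
Qed.

Lemma size_low_comps0 m k t : size (low_comps 0 m.+1 k t) = size (comps k t).
Proof.
rewrite size_filter; apply/eqP; rewrite -all_count; apply/allP => l _.
by rewrite take0.
Qed.

(** A monomial either omits the first variable or is divisible by it; the division lowers both the
    degree and the bound on the partial degree. *)
Lemma size_low_compsS c m k t :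
  size (low_comps c.+1 m.+1 k.+1 t.+1) =
    size (low_comps c m.+1 k t.+1) + size (low_comps c.+1 m k.+1 t).
Proof.
rewrite !size_filter compsSS count_cat !count_map; congr addn.
apply: eq_in_count => -[|x l]; rewrite mem_comps //= => _.
Qed.

(** Vandermonde convolution: monomials of degree [r] in [a.+1] plus [b.+1] variables, sorted by
    their degree [k] in the second group. The proof is a double induction with Pascal's rule. *)
Lemma bin_convolution r a b :
  \sum_(k < r.+1) 'C(a + (r - k), r - k) * 'C(b + k, k) = 'C(a.+1 + b + r, r).
Proof.
(* The hockey-stick identity, which is the case [b = 0]. *)
have rowsum : forall r, \sum_(k < r.+1) 'C(a + (r - k), r - k) = 'C(a.+1 + r, r).
  move=> {}r; rewrite (reindex_inj rev_ord_inj) /=.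
  under eq_bigr => k _ do rewrite subSS subKn -1?ltnS //.
  elim: r => [|r IHr]; first by rewrite big_ord1 !bin0.
  by rewrite big_ord_recr /= IHr [in RHS]addnS binS addnC addSnnS.
elim: r b => [|r IHr] b; first by rewrite big_ord1 !bin0.
elim: b => [|b IHb].
  by rewrite addn0 -rowsum; apply: eq_bigr => k _; rewrite add0n binn muln1.
have -> : 'C(a.+1 + b.+1 + r.+1, r.+1) =
          'C(a.+1 + b + r.+1, r.+1) + 'C(a.+1 + b.+1 + r, r).
  by rewrite addnS binS; congr ('C(_, _) + _); lia.
rewrite -IHb -IHr big_ord_recl [in RHS]big_ord_recl /= !bin0 -addnA; congr addn.
rewrite -big_split; apply: eq_bigr => k _ /=.
rewrite /bump add1n subSS -mulnDr; congr muln.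
by rewrite [in LHS]addSn binS addSnnS.
Qed.

(** Both sides obey the recurrence [size_low_compsS], the right one by Pascal's rule; for [c = 0]
    the bound is vacuous and [bin_convolution] applies. The degree [a.+1 + b] encodes [m <= t]. *)
Lemma size_low_comps c r a b :
  size (low_comps c a.+1 (c + r).+1 (a.+1 + b)) =
    \sum_(k < r.+1) 'C(a + (c + (r - k)), c + (r - k)) * 'C(b + k, k).
Proof.
elim: c a => [|c IHc] a; first by rewrite size_low_comps0 size_comps -bin_convolution.
elim: a => [|a IHa].
  rewrite (size_low_compsS c 0) IHc [X in _ + X](_ : _ = 0) ?addn0.
    by apply: eq_bigr => k _; rewrite !add0n !binn.
  by rewrite size_filter; apply/eqP; rewrite -leqn0 leqNgt -has_count; apply/hasPn.
rewrite addSn size_low_compsS -addSn IHc IHa -big_split; apply: eq_bigr => k _ /=.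
rewrite -mulnDl; congr muln.
move: (r - k) => j; rewrite !(addSn c) [in RHS]addnS binS addnC.
by rewrite addSnnS.
Qed.

Lemma size_low_comps_sum n r m t : r <= n -> 0 < m -> m <= t ->
  size (low_comps (n - r) m n.+1 t) =
    \sum_(k < r.+1) 'C(m.-1 + (n - k), n - k) * 'C(t - m + k, k).
Proof.
move=> rn; case: m => // a _ mt.
rewrite -{2}(subnK rn) -{1}(subnKC mt) size_low_comps /=.
apply: eq_bigr => k _; have kr : k <= r by rewrite -ltnS.
by rewrite addnBA // subnK.
Qed.

(** * Hilbert polynomials *)

Local Open Scope classical_set_scope.
Local Open Scope ring_scope.

Lemma bin_rising (F : numFieldType) (a k : nat) :
  'C(a + k, k)%:R = (k`!%:R)^-1 * \prod_(i < k) (a%:R + i.+1%:R) :> F.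
Proof.
elim: k => [|k IHk]; first by rewrite bin0 big_ord0 fact0 invr1 mulr1.
have := mul_bin_diag (a + k.+1) k; rewrite [X in X.-1]addnS [(a + k).+1.-1]/=.
move=> /(congr1 (fun i => i%:R : F)).
rewrite factS !natrM IHk big_ord_recr -natrD /=.
have k0 : k.+1%:R != 0 :> F by rewrite pnatr_eq0.
have f0 : k`!%:R != 0 :> F by rewrite pnatr_eq0 -lt0n fact_gt0.
by move=> h; apply: (mulfI k0); rewrite -h; field; rewrite f0 addrC natr1 k0.
Qed.

(** The binomial coefficient of [p + k] over [k] as a polynomial; [bin_rising] gives its values at
    natural numbers. *)
Definition rising (k : nat) (p : {poly rat}) : {poly rat} :=
  (k`!%:R)^-1 *: \prod_(i < k) (p + (i.+1%:R)%:P).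

Definition rising_poly (k : nat) (p : {poly {poly rat}}) : {poly {poly rat}} :=
  ((k`!%:R)^-1)%:P%:P * \prod_(i < k) (p + i.+1%:R).

Lemma horner_rising k p (x : rat) :
  (rising k p).[x] = (k`!%:R)^-1 * \prod_(i < k) (p.[x] + i.+1%:R).
Proof.
rewrite hornerZ horner_prod; congr (_ * _); apply: eq_bigr => i _.
by rewrite !hornerE.
Qed.

Lemma comp_rising k p q : rising k p \Po q = rising k (p \Po q).
Proof.
rewrite /rising comp_polyZ rmorph_prod; congr (_ *: _); apply: eq_bigr => i _ /=.
by rewrite comp_polyD comp_polyC.
Qed.

Lemma horner_rising_poly k p (x : {poly rat}) :
  (rising_poly k p).[x] = rising k p.[x].
Proof.
rewrite /rising_poly /rising hornerM hornerC -mul_polyC horner_prod; congr (_ * _).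
apply: eq_bigr => i _; rewrite hornerD -[in LHS](polyC_natr _ i.+1) hornerC.
by rewrite polyC_natr.
Qed.

(* Bidegree: degree at most [N] in the outer variable, at most [d] in the inner one. *)
Definition bideg_le (N d : nat) (p : {poly {poly rat}}) :=
  (size p <= N.+1)%N /\ forall i, (size (p`_i)%R <= d.+1)%N.

Lemma bideg_leW N d N' d' p : (N <= N')%N -> (d <= d')%N ->
  bideg_le N d p -> bideg_le N' d' p.
Proof.
move=> hN hd [sp cp]; split; first exact: leq_trans sp _.
by move=> i; apply: leq_trans (cp i) _.
Qed.

Lemma bideg_leD N d p q : bideg_le N d p -> bideg_le N d q -> bideg_le N d (p + q).
Proof.
move=> [sp cp] [sq cq]; split.
  by apply: leq_trans (size_polyD _ _) _; rewrite geq_max sp sq.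
by move=> i; rewrite coefD; apply: leq_trans (size_polyD _ _) _; rewrite geq_max cp cq.
Qed.

Lemma bideg_leM N d N' d' p q :
  bideg_le N d p -> bideg_le N' d' q -> bideg_le (N + N') (d + d') (p * q).
Proof.
move=> [sp cp] [sq cq]; split.
  apply: leq_trans (size_polyMleq _ _) _; lia.
move=> i; rewrite coefM; apply: leq_trans (size_sum _ _ _) _.
apply/bigmax_leqP => j _; apply: leq_trans (size_polyMleq _ _) _.
by have := cp j; have := cq (i - j)%N; lia.
Qed.

Lemma bideg_leC (p : {poly rat}) d : (size p <= d.+1)%N -> bideg_le 0 d p%:P.
Proof.
move=> sp; split; first exact: size_polyC_leq1.
by move=> i; rewrite coefC; case: ifP => // _; rewrite size_poly0.
Qed.

Lemma bideg_le_nat (k : nat) : bideg_le 0 0 k%:R.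
Proof.
rewrite -(polyC_natr {poly rat} k) -(polyC_natr rat k).
by apply: bideg_leC; apply: size_polyC_leq1.
Qed.

Lemma bideg_leX : bideg_le 1 0 'X.
Proof.
split; first by rewrite size_polyX.
by move=> i; rewrite coefX; case: eqP => _; rewrite ?size_poly1 ?size_poly0.
Qed.

Lemma bideg_le_sum N d I (s : seq I) (P : pred I) (F : I -> {poly {poly rat}}) :
  (forall i, P i -> bideg_le N d (F i)) -> bideg_le N d (\sum_(i <- s | P i) F i).
Proof.
move=> h; elim/big_ind: _ => //; last by move=> p q; apply: bideg_leD.
by apply: (@bideg_leW 0 0) => //; apply: (bideg_le_nat 0).
Qed.

Lemma bideg_le_rising k N d p :
  bideg_le N d p -> bideg_le (k * N) (k * d) (rising_poly k p).
Proof.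
move=> hp; rewrite /rising_poly -[(k * N)%N]add0n -[(k * d)%N]add0n.
apply: bideg_leM; first by apply: bideg_leC; apply: size_polyC_leq1.
elim: k => [|k IHk]; first by rewrite big_ord0; apply: (bideg_le_nat 1).
rewrite big_ord_recr /= !mulSn addnC [(d + _)%N]addnC; apply: bideg_leM => //.
by apply: bideg_leD => //; apply: bideg_leW (bideg_le_nat _).
Qed.

(** The sum of [size_low_comps_sum] with [t] as indeterminate, once for each of the [s]
    subspaces. *)
Definition fat_hilbert (n r s m : nat) : {poly rat} :=
  s%:R *: \sum_(k < r.+1) 'C(m.-1 + (n - k), n - k)%:R *: rising k ('X - (m%:R)%:P).

(* [fat_hilbert n r s m] at [m t], with outer variable [m] and inner variable [t]. *)
Definition fat_hilbert_in_m (n r s : nat) : {poly {poly rat}} :=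
  s%:R * \sum_(k < r.+1) rising_poly (n - k) ('X - 1)
                         * rising_poly k ('X * ('X%:P - 1)).

Lemma fat_hilbert_in_mE n r s m : (0 < m)%N ->
  (fat_hilbert_in_m n r s).[m%:R] = fat_hilbert n r s m \Po (m%:R *: 'X).
Proof.
move=> m0; rewrite /fat_hilbert_in_m /fat_hilbert hornerM -(polyC_natr _ s) hornerC.
rewrite comp_polyZ -mul_polyC polyC_natr horner_sum linear_sum; congr (_ * _).
apply: eq_bigr => k _; rewrite hornerM !horner_rising_poly /=.
rewrite comp_polyZ comp_rising -mul_polyC; congr (_ * _).
  rewrite bin_rising /rising polyCM -mul_polyC; congr (_ * _).
  rewrite rmorph_prod; apply: eq_bigr => i _ /=.
  rewrite !hornerE polyCD; congr (_ + _).
  (* Here [0 < m] identifies [m.-1] with [m - 1]. *)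
  by rewrite -{1}(prednK m0) -[m.-1.+1]addn1 natrD addrK polyC_natr.
congr rising; rewrite hornerM hornerX hornerD hornerC hornerN hornerC.
rewrite comp_polyB comp_polyX comp_polyC mulrBr mulr1 -mul_polyC polyC_natr //.
Qed.

Lemma horner_fat_hilbert n r s m t : (r <= n)%N -> (0 < m)%N -> (m <= t)%N ->
  (fat_hilbert n r s m).[t%:R] = (s * size (low_comps (n - r) m n.+1 t))%:R.
Proof.
move=> rn m0 mt; rewrite size_low_comps_sum // hornerZ natrM; congr (_ * _).
rewrite horner_sum natr_sum; apply: eq_bigr => k _.
rewrite hornerZ natrM horner_rising; congr (_ * _).
by rewrite bin_rising !hornerE natrB.
Qed.

Lemma bideg_fat_hilbert_in_m n r s : (r <= n)%N ->
  bideg_le n r (fat_hilbert_in_m n r s).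
Proof.
move=> rn; rewrite /fat_hilbert_in_m.
rewrite -[n in bideg_le n]add0n -[r in bideg_le _ r]add0n.
apply: bideg_leM; first exact: bideg_le_nat.
apply: bideg_le_sum => k _; have kr : (k <= r)%N by rewrite -ltnS.
(* The first factor has degree [n - k] in [m] and 0 in [t]; the second has degree [k] in both. *)
apply: (@bideg_leW ((n - k) * 1 + k * 1) ((n - k) * 0 + k * 1)); [lia|lia|].
have b1 : bideg_le 0 0 (- 1).
  have -> : (-1 : {poly {poly rat}}) = (- 1)%:P by rewrite polyCN.
  by apply: bideg_leC; rewrite size_polyN size_poly1.
apply: bideg_leM; apply: bideg_le_rising.
  by apply: bideg_leD; [exact: bideg_leX|apply: bideg_leW b1].
apply: (@bideg_leM 1 0 0 1); first exact: bideg_leX.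
apply: bideg_leD; last by apply: bideg_leW b1.
by apply: bideg_leC; rewrite size_polyX.
Qed.

Definition binomial_in_m (n : nat) : {poly {poly rat}} :=
  rising_poly n ('X * 'X%:P).

(** * Symbolic powers of intersections of primes *)

Section IdealTheory.
Variable A : idomainType.
Implicit Types (I J P : set A).

Lemma ideal_genP (S : set A) : is_ideal (ideal_gen S).
Proof.
split.
- by move=> J [[]].
- move=> a b ha hb J hJ; case: (hJ) => -[_ hD _] _.
  by apply: hD; [apply: ha|apply: hb].
- move=> a b hb J hJ; case: (hJ) => -[_ _ hM] _.
  by apply: hM; apply: hb.
Qed.

Lemma ideal_gen_min (S J : set A) : is_ideal J -> S `<=` J -> ideal_gen S `<=` J.
Proof. by move=> hJ SJ a; apply. Qed.

Lemma ideal_pow_ideal I m : is_ideal (ideal_pow I m).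
Proof. exact: ideal_genP. Qed.

Lemma mem_ideal_pow I m (f : 'I_m -> A) :
  (forall i, I (f i)) -> ideal_pow I m (\prod_(i < m) f i).
Proof. by move=> hf J [_]; apply; exists f. Qed.

Lemma ideal_pow_min I m J : is_ideal J ->
  (forall f : 'I_m -> A, (forall i, I (f i)) -> J (\prod_(i < m) f i)) ->
  ideal_pow I m `<=` J.
Proof. by move=> hJ hf; apply: ideal_gen_min => // _ [f If ->]; apply: hf. Qed.

Lemma ideal_pow_mono I J m : I `<=` J -> ideal_pow I m `<=` ideal_pow J m.
Proof.
move=> IJ; apply: ideal_pow_min; first exact: ideal_pow_ideal.
by move=> f If; apply: mem_ideal_pow => i; apply: IJ.
Qed.

Lemma ideal_pow0 I a : ideal_pow I 0 a.
Proof.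
have [_ _ hM] := ideal_pow_ideal I 0.
rewrite -[a]mulr1; apply: hM.
have f0 : 'I_0 -> A by case.
by have := @mem_ideal_pow I 0 f0; rewrite big_ord0; apply; case.
Qed.

Lemma is_ideal_colon J b : is_ideal J -> is_ideal [set a | J (b * a)].
Proof.
move=> [h0 hD hM]; split=> /=.
- by rewrite mulr0.
- by move=> a c ha hc; rewrite mulrDr; apply: hD.
- by move=> a c hc; rewrite mulrCA; apply: hM.
Qed.

(** The colon ideal of [ideal_pow I m.+1] by [q] contains the generators of [ideal_pow I m]. *)
Lemma ideal_powS I m q a : I q -> ideal_pow I m a -> ideal_pow I m.+1 (q * a).
Proof.
move=> Iq; have hJ := is_ideal_colon q (ideal_pow_ideal I m.+1).
apply: (ideal_pow_min hJ) => f If /=.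
have := @mem_ideal_pow I m.+1 (fun i => oapp f q (unlift ord0 i)).
rewrite big_ord_recl unlift_none /=.
under eq_bigr => i _ do rewrite liftK /=.
by apply=> i; case: (unlift ord0 i) => [j|] //=.
Qed.

Lemma prime_ideal_prod P (T : eqType) (s : seq T) (f : T -> A) : is_prime_ideal P ->
  P (\prod_(i <- s) f i) -> exists2 i, i \in s & P (f i).
Proof.
move=> [_ P1 PM]; elim: s => [|i s IHs]; first by rewrite big_nil.
rewrite big_cons => /PM[hi|/IHs[j js hj]]; first by exists i; rewrite ?mem_head.
by exists j => //; rewrite inE js orbT.
Qed.

Lemma ideal_prod I (T : eqType) (s : seq T) (f : T -> A) i : is_ideal I ->
  i \in s -> I (f i) -> I (\prod_(j <- s) f j).
Proof.
move=> [_ _ hM]; elim: s => // j s IHs; rewrite inE big_cons => /orP[/eqP<-|js] Ii.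
  by rewrite mulrC; apply: hM.
by apply: hM; apply: IHs.
Qed.

Section PrimaryDecomposition.
Variables (s : nat) (Q : 'I_s -> set A).
Hypothesis primeQ : forall i, is_prime_ideal (Q i).
Hypothesis incomparable : forall i j, i != j -> exists2 q, Q j q & ~ Q i q.

Let I : set A := [set a | forall i, Q i a].

(** Take the product over [j != i] of elements of [Q j] outside [Q i]; primality keeps it outside
    [Q i]. *)
Lemma avoid_prime i : exists2 b, ~ Q i b & forall j, j != i -> Q j b.
Proof.
have /choice[f hf] : forall j, exists q, j != i -> Q j q /\ ~ Q i q.
  move=> j; have [->|ji] := eqVneq j i; first by exists 0.
  by have [|q Qq Nq] := @incomparable i j; [rewrite eq_sym|exists q].
exists (\prod_(j <- enum (predC1 i)) f j).
  move/(prime_ideal_prod (primeQ i)) => [j]; rewrite mem_enum => ji.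
  by have [] := hf j ji.
move=> j ji; apply: (@ideal_prod _ _ _ _ j); first by case: (primeQ j).
  by rewrite mem_enum.
by have [] := hf j ji.
Qed.

(** If [P] is the colon ideal of [I] by [a], the product of the [Q i] not containing [a] lies in
    [P], so one of them does; conversely [x * a] in [Q i] with [a] outside puts [x] in [Q i]. *)
Lemma associated_prime_bigcap P :
  associated_prime I P <-> exists i, P = Q i.
Proof.
split=> [[pP [a defP]]|[i ->]].
- have [/forallP ha|/forallPn[i0 _]] := boolP [forall i, `[<Q i a>]].
    by case: pP => _ + _; case; rewrite defP /= mul1r => i; apply/asboolP.
  (* [f i] witnesses that [Q i] is not contained in [P] whenever this holds, and is 0 otherwise. *)
  have /choice[f hf] : forall i, exists q, Q i q /\ ((forall x, Q i x -> P x) \/ ~ P q).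
    move=> i; have [h|h] := pselect (forall x, Q i x -> P x).
      by exists 0; split; [case: (primeQ i) => -[]|left].
    by move/existsNP: h => [q /not_implyP[Qq Pq]]; exists q; split; [|right].
  have : P (\prod_(i <- enum [pred i | `[<~ Q i a>]]) f i).
    rewrite defP => i /=; have [Qa|NQa] := pselect (Q i a).
      by case: (primeQ i) => -[_ _ hM] _ _; apply: hM.
    rewrite mulrC; case: (primeQ i) => hI _ _; case: (hI) => _ _; apply.
    apply: (@ideal_prod _ _ _ _ i) => //; last by case: (hf i).
    by rewrite mem_enum inE.
  move/(prime_ideal_prod pP) => [i]; rewrite mem_enum inE => Na Pf.
  exists i; apply/seteqP; split=> x.
    by rewrite defP => /(_ i); case: (primeQ i) => _ _ /[apply] -[].
  by have [_ []] := hf i; [apply|].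
- split=> //; have [b Nb hb] := avoid_prime i.
  (* [b] lies in every prime except [Q i], so the colon ideal of [I] by [b] is [Q i]. *)
  exists b; apply/seteqP; split=> x /=.
    move=> Qx j; have [->|ji] := eqVneq j i.
      by rewrite mulrC; case: (primeQ i) => -[_ _ hM] _ _; apply: hM.
    by case: (primeQ j) => -[_ _ hM] _ _; apply: hM; apply: hb.
  by move/(_ i); case: (primeQ i) => _ _ /[apply] -[].
Qed.

Lemma localizationE J P a : is_ideal J -> is_ideal P ->
  localization J P (tofrac a) <-> exists2 b, ~ P b & J (b * a).
Proof.
move=> hJ hP; split=> [[c [b [Jc Pb]]]|[b Pb Jba]].
  have b0 : b != 0 by apply/eqP => b0; apply: Pb; rewrite b0; case: hP.
  move/(congr1 (fun x => x * tofrac b)); rewrite mulfVK ?tofrac_eq0 //.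
  rewrite -tofracM => /eqP; rewrite tofrac_eq => /eqP abc.
  by exists b => //; rewrite mulrC abc.
have b0 : b != 0 by apply/eqP => b0; apply: Pb; rewrite b0; case: hP.
exists (b * a), b; split=> //.
by rewrite tofracM mulrAC mulfV ?mul1r // tofrac_eq0.
Qed.

(** Localizing at [Q i] allows a multiplier outside [Q i]. Primariness cancels it in one direction;
    in the other, a power of the element from [avoid_prime] serves as multiplier. *)
Theorem symbolic_power_bigcap m :
  (forall i a b, ~ Q i b -> ideal_pow (Q i) m (b * a) -> ideal_pow (Q i) m a) ->
  symbolic_power I m = [set a | forall i, ideal_pow (Q i) m a].
Proof.
move=> primary; apply/seteqP; split=> a /= ha.
  move=> i; have /ha : associated_prime I (Q i).
    by apply/associated_prime_bigcap; exists i.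
  move/localizationE => -[|| b Nb hb].
  - exact: ideal_pow_ideal.
  - by case: (primeQ i).
  - apply: primary Nb _; move: hb; apply: ideal_pow_mono => x; exact.
move=> P /associated_prime_bigcap[i ->]; apply/localizationE.
- exact: ideal_pow_ideal.
- by case: (primeQ i).
have [b Nb hb] := avoid_prime i.
(* Each of the [m] factors from [Q i] absorbs one [b], and the products lie in [I]. *)
exists (b ^+ m).
  elim: m {primary ha} => [|k IHk]; first by case: (primeQ i).
  by rewrite exprS; case: (primeQ i) => _ _ /[apply] -[].
move: (ha i); have hJ := is_ideal_colon (b ^+ m) (ideal_pow_ideal I m).
apply: (ideal_pow_min hJ) => f Qf /=.
have -> : b ^+ m * \prod_(k < m) f k = \prod_(k < m) (b * f k).
  by rewrite big_split prodr_const card_ord.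
apply: mem_ideal_pow => k j; have [->|ji] := eqVneq j i.
  by case: (primeQ i) => -[_ _ hM] _ _; apply: hM.
by rewrite mulrC; case: (primeQ j) => -[_ _ hM] _ _; apply: hM; apply: hb.
Qed.

End PrimaryDecomposition.
End IdealTheory.

(** * Linear changes of coordinates *)

Section Coordinates.
Variables (K : fieldType) (n : nat).
Implicit Types (g h : 'M[K]_n) (f : {mpoly K[n]}) (m : 'X_{1..n}).

(** The index order [g j i] makes the substitution dual to the action [v *m g] on row vectors. *)
Definition coord_tuple g : n.-tuple {mpoly K[n]} :=
  [tuple \sum_j g j i *: 'X_j | i < n].

Lemma meval_coord g f (v : 'rV[K]_n) :
  (f \mPo coord_tuple g).@[v 0] = f.@[(v *m g) 0].
Proof.
rewrite comp_mpoly_meval; apply: meval_eq => i.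
rewrite tnth_mktuple mxE raddf_sum /=; apply: eq_bigr => j _.
by rewrite mevalZ mevalXU mulrC.
Qed.

Lemma coord_comp g h f :
  (f \mPo coord_tuple h) \mPo coord_tuple g = f \mPo coord_tuple (g *m h).
Proof.
rewrite (comp_mpolyEX _ (coord_tuple h)) (comp_mpolyEX f) raddf_sum; apply: eq_bigr => m _ /=.
rewrite comp_mpolyZ !comp_mpolyX rmorph_prod; congr (_ *: _); apply: eq_bigr => i _ /=.
rewrite rmorphXn /= !tnth_mktuple; congr (_ ^+ _).
rewrite raddf_sum /=.
under eq_bigr => j _.
  rewrite comp_mpolyZ comp_mpolyXU -tnth_nth tnth_mktuple scaler_sumr.
  under eq_bigr => k _ do rewrite scalerA.
  over.
rewrite exchange_big; apply: eq_bigr => k _ /=.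
by rewrite mxE scaler_suml; apply: eq_bigr => j _; rewrite mulrC.
Qed.

Lemma coord1 f : f \mPo coord_tuple 1%:M = f.
Proof.
rewrite -[RHS]comp_mpoly_id; congr (_ \mPo _); apply: eq_from_tnth => i.
rewrite !tnth_mktuple (bigD1 i) //= mxE eqxx scale1r big1 ?addr0 // => j ji.
by rewrite mxE (negbTE ji) scale0r.
Qed.

Lemma coordK g f : g \in unitmx ->
  (f \mPo coord_tuple g) \mPo coord_tuple (invmx g) = f.
Proof. by move=> gU; rewrite coord_comp mulVmx // coord1. Qed.

Lemma coordKV g f : g \in unitmx ->
  (f \mPo coord_tuple (invmx g)) \mPo coord_tuple g = f.
Proof. by move=> gU; rewrite coord_comp mulmxV // coord1. Qed.

Lemma dhomog_coord g f t : f \is t.-homog -> f \mPo coord_tuple g \is t.-homog.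
Proof.
move=> /dhomogP hf; rewrite comp_mpolyEX; apply: rpred_sum => m _.
have [mf|] := boolP (m \in msupp f); last first.
  by move=> /memN_msupp_eq0 ->; rewrite scale0r rpred0.
apply: rpredZ; rewrite comp_mpolyX -(hf m mf) /= mdegE.
elim/big_rec2: _ => [|i p d _ IH]; first exact: dhomog1.
apply: dhomogM => //; rewrite -[m i in X in X.-homog]mul1n; apply: dhomogMn.
rewrite tnth_mktuple; apply: rpred_sum => j _; apply: rpredZ.
by rewrite dhomogX /= mdeg1.
Qed.

Definition ldeg (c : nat) m : nat := (\sum_(i < n | (i < c)%N) m i)%N.

Lemma ldegD c m1 m2 : ldeg c (m1 + m2)%MM = (ldeg c m1 + ldeg c m2)%N.
Proof. by rewrite /ldeg -big_split; apply: eq_bigr => i _; rewrite mnmDE. Qed.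

Lemma ldeg1 c i : ldeg c U_(i)%MM = (i < c)%N.
Proof.
rewrite /ldeg; case: ltnP => ic.
  rewrite (bigD1 i) //= mnm1E eqxx big1 ?addn0 // => j /andP[_ ji].
  by rewrite mnm1E eq_sym (negbTE ji).
rewrite big1 // => j jc; rewrite mnm1E; case: eqP => // ij.
by move: jc; rewrite -ij ltnNge ic.
Qed.

Lemma ldeg_gt0 c m : (0 < ldeg c m)%N ->
  exists2 i : 'I_n, (i < c)%N & (0 < m i)%N.
Proof.
move=> hm; apply: contrapT => h; move: hm; rewrite /ldeg big1 // => i ic.
by apply/eqP; rewrite -leqn0 leqNgt; apply/negP => mi; apply: h; exists i.
Qed.

Lemma addm_mnm1 m i : (0 < m i)%N -> m = (U_(i) + (m - U_(i)))%MM.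
Proof.
move=> mi; rewrite addmC submK //; apply/mnm_lepP => j.
by rewrite mnm1E; case: eqP => // <-.
Qed.

(* Multiplies each of the first [c] variables by a new variable, whose exponent
   then records the degree in those variables. *)
Definition mark (c : nat) : {mpoly K[n]} -> {poly {mpoly K[n]}} :=
  mmap (polyC \o @mpolyC n K)
       (fun i => if (i < c)%N then ('X_i)%:P * 'X else ('X_i)%:P).

HB.instance Definition _ c := GRing.RMorphism.copy (mark c)
  (mmap (polyC \o @mpolyC n K)
       (fun i => if (i < c)%N then ('X_i)%:P * 'X else ('X_i)%:P)).

Lemma markX c m : mark c 'X_[m] = ('X_[m])%:P * 'X^(ldeg c m).
Proof.
rewrite /mark mmapX /mmap1 [in RHS]mpolyXE_id rmorph_prod /ldeg. rewrite /=.
rewrite -prodrXr [X in _ * X]big_mkcond -big_split /=; apply: eq_bigr => i _ /=.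
by case: ifP => _; rewrite ?exprMn ?expr0 ?mulr1 ?rmorphXn /=.
Qed.

Lemma markZ c a f : mark c (a *: f) = a%:MP%:P * mark c f.
Proof. by rewrite /mark mmapZ. Qed.

Lemma coef_mark c f j m : (mark c f)`_j@_m = f@_m *+ (ldeg c m == j).
Proof.
rewrite [f in LHS]mpolyE raddf_sum /= coef_sum raddf_sum /=.
rewrite [f in RHS]mpolyE raddf_sum /= -sumrMnl; apply: eq_bigr => m' _.
rewrite markZ markX coefCM coefCM coefXn mulr_natr mcoeffCM mcoeffMn mcoeffZ mcoeffX.
have [->|] := eqVneq m' m; last by rewrite mulr0n mul0rn mulr0 mul0rn.
by rewrite mulrnAr [in RHS]eq_sym.
Qed.

(** A lower bound on the ['X]-adic valuation. For [mark c f] it says that all monomials of [f] have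
    partial degree at least [k]. *)
Definition ord_ge (A : nzRingType) (k : nat) (p : {poly A}) :=
  forall j, (j < k)%N -> p`_j = 0.

Lemma ord_geM (A : idomainType) k l (p q : {poly A}) :
  ord_ge k p -> ord_ge l q -> ord_ge (k + l) (p * q).
Proof.
move=> hp hq j jkl; rewrite coefM big1 // => i _.
have [ik|ki] := ltnP i k; first by rewrite hp ?mul0r.
have ij : (i <= j)%N by rewrite -ltnS.
by rewrite [q`_ _]hq ?mulr0 // -subSn // leq_subLR (leq_trans jkl) // leq_add2r.
Qed.

Lemma ord_geM_reg (A : idomainType) k (p q : {poly A}) :
  p`_0 != 0 -> ord_ge k (p * q) -> ord_ge k q.
Proof.
move=> p0 hpq j; elim/ltn_ind: j => j IHj jk.
have := hpq j jk; rewrite coefM big_ord_recl subn0 big1 ?addr0 => [/eqP|i _].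
  by rewrite mulf_eq0 (negbTE p0) => /eqP.
rewrite IHj ?mulr0 //; last by apply: leq_ltn_trans jk; rewrite leq_subr.
by rewrite /= /bump add1n ltn_subrL (leq_trans _ (ltn_ord i)).
Qed.

(* The [k]-th power of the ideal of [y_0 = ... = y_(c-1) = 0] in the coordinates [y]
   given by [x = y *m g]. *)
Definition fat_ideal g (c k : nat) : set {mpoly K[n]} :=
  [set f | forall m, (ldeg c m < k)%N -> (f \mPo coord_tuple g)@_m = 0].

Lemma fat_idealE g c k f :
  fat_ideal g c k f <-> ord_ge k (mark c (f \mPo coord_tuple g)).
Proof.
split=> [hf j jk|hf m mk].
  by apply/mpolyP => m; rewrite coef_mark mcoeff0; case: eqP => // mj; rewrite hf ?mj.
by have := coef_mark c (f \mPo coord_tuple g) (ldeg c m) m; rewrite hf // mcoeff0 eqxx.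
Qed.

Lemma fat_ideal_mul g c k l f1 f2 :
  fat_ideal g c k f1 -> fat_ideal g c l f2 -> fat_ideal g c (k + l) (f1 * f2).
Proof. by rewrite !fat_idealE !rmorphM; apply: ord_geM. Qed.

Lemma is_ideal_fat g c k : is_ideal (fat_ideal g c k).
Proof.
split=> [m _|f1 f2 h1 h2 m mk|f1 f2 h2].
- by rewrite comp_mpoly0 mcoeff0.
- by rewrite comp_mpolyD mcoeffD h1 // h2 // addr0.
- exact: (@fat_ideal_mul g c 0 k).
Qed.

(** Outside the prime, the marked polynomial has a nonzero constant coefficient, so it cannot raise
    the valuation of a product. *)
Lemma fat_ideal_primary g c k f1 f2 :
  ~ fat_ideal g c 1 f1 -> fat_ideal g c k (f1 * f2) -> fat_ideal g c k f2.
Proof.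
rewrite !fat_idealE !rmorphM => h1; apply: ord_geM_reg.
by apply/eqP => h0; apply: h1 => -[].
Qed.

Lemma is_prime_fat g c : is_prime_ideal (fat_ideal g c 1).
Proof.
split; first exact: is_ideal_fat.
  move=> /(_ 0%MM); rewrite comp_mpoly1 mcoeff1 eqxx => h.
  have /eqP : (1 : K) = 0 by apply: h; rewrite /ldeg big1 // => i _; rewrite mnm0E.
  by rewrite oner_eq0.
move=> f1 f2 h; have [|h1] := pselect (fat_ideal g c 1 f1); first by left.
by right; apply: fat_ideal_primary h1 h.
Qed.

(** Valuations add, which gives one inclusion. For the other, expand in adapted coordinates and
    extract [k] of the first [c] variables from each monomial. *)
Lemma fat_ideal_pow g c k : g \in unitmx ->
  fat_ideal g c k = ideal_pow (fat_ideal g c 1) k.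
Proof.
move=> gU; apply/seteqP; split; last first.
  apply: ideal_pow_min; first exact: is_ideal_fat.
  elim: k => [|k IHk] f hf; first by [].
  rewrite big_ord_recl; apply: (@fat_ideal_mul _ _ 1 k) => //.
  by apply: IHk => i; apply: hf.
have hX m l : (l <= ldeg c m)%N ->
    ideal_pow (fat_ideal g c 1) l ('X_[m] \mPo coord_tuple (invmx g)).
  elim: l m => [|l IHl] m hm; first exact: ideal_pow0.
  have [i ic mi] := ldeg_gt0 (leq_ltn_trans (leq0n l) hm).
  have mE := addm_mnm1 mi.
  rewrite [m]mE mpolyXD rmorphM; apply: ideal_powS.
    move=> m' hm'; rewrite coordKV // mcoeffX; case: eqP => // im.
    by move: hm'; rewrite -im ldeg1 ic.
  by apply: IHl; move: hm; rewrite {1}mE ldegD ldeg1 ic.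
have [h0 hD hM] := ideal_pow_ideal (fat_ideal g c 1) k.
move=> f hf; rewrite -[f](coordK _ gU) [X in X \mPo coord_tuple (invmx g)]mpolyE.
rewrite raddf_sum /=; apply: (big_ind (ideal_pow (fat_ideal g c 1) k)) => // m _.
rewrite comp_mpolyZ -mul_mpolyC.
have [mk|km] := ltnP (ldeg c m) k; first by rewrite hf // mpolyC0 mul0r.
by apply: hM; apply: hX.
Qed.

End Coordinates.

(** * Ideals of linear subspaces *)

(** Otherwise the difference would have more roots among the naturals from [N] on than its degree
    allows. *)
Lemma poly_eq_nat (A : idomainType) (p q : {poly A}) N :
  injective (fun i : nat => i%:R : A) ->
  (forall m : nat, (N <= m)%N -> p.[m%:R] = q.[m%:R]) -> p = q.
Proof.
move=> inj pq; apply/eqP; rewrite -subr_eq0; apply: contraT => d0.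
suff: (size [seq i%:R : A | i <- iota N (size (p - q)%R)] < size (p - q)%R)%N.
  by rewrite size_map size_iota ltnn.
apply: max_poly_roots => //; last by rewrite map_inj_uniq ?iota_uniq.
apply/allP => _ /mapP[i /[!mem_iota]/andP[Ni _] ->].
by rewrite /root !hornerE pq // subrr.
Qed.

Lemma digits_inj b n (x y : 'I_n -> nat) :
  (forall i, x i < b)%N -> (forall i, y i < b)%N ->
  (\sum_(i < n) x i * b ^ i = \sum_(i < n) y i * b ^ i)%N -> x =1 y.
Proof.
elim: n x y => [|n IHn] x y hx hy; first by move=> _ [].
rewrite !big_ord_recl !expn0 !muln1.
have shift (z : 'I_n.+1 -> nat) : (\sum_(i < n) z (lift ord0 i) * b ^ lift ord0 i
    = (\sum_(i < n) z (lift ord0 i) * b ^ i) * b)%N.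
  by rewrite big_distrl; apply: eq_bigr => i _ /=; rewrite /bump add1n expnSr mulnA.
rewrite !shift addnC [RHS]addnC => E.
have E0 : x ord0 = y ord0.
  by move/(congr1 (modn^~ b)): (E); rewrite !modnMDl !modn_small.
move: E; rewrite E0 => /addIn/eqP; rewrite eqn_pmul2r; last first.
  exact: leq_ltn_trans (hx ord0).
move=> /eqP /IHn h i; have [j ->|->] := unliftP ord0 i; last by [].
by apply: h => k; [apply: hx|apply: hy].
Qed.

(** * Points where a nonzero polynomial does not vanish *)

Section Nonvanishing.
Variables (K : fieldType) (n : nat).
Hypothesis charK : [pchar K] =i pred0.

Lemma natr_inj_pchar0 : injective (fun i : nat => i%:R : K).
Proof.
move=> i j; wlog ij : i j / (i <= j)%N => [h|].
  by case: (leqP i j) => [|/ltnW] ij /= e; [exact: h|apply/esym/h].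
rewrite -(subnK ij) natrD -{1}[i%:R]add0r => /addIr/esym/eqP.
by rewrite (proj1 (pcharf0P K) charK) => /eqP ->.
Qed.

Lemma poly_nonroot (p : {poly K}) : p != 0 -> exists2 x, x != 0 & p.[x] != 0.
Proof.
move=> p0; apply: contrapT => h; case/eqP: p0.
(* Starting at 1 keeps the root 0 out, as the point sought must be nonzero. *)
apply: (@poly_eq_nat _ _ _ 1 natr_inj_pchar0) => i i0; rewrite horner0.
apply: contrapT => /eqP pi; apply: h; exists i%:R => //.
by rewrite -[0]/(0%:R) (inj_eq natr_inj_pchar0) -lt0n.
Qed.

(* Kronecker substitution: [X_i := x^(b^i)] separates the monomials of [f] when
   [b] exceeds all exponents. *)
Lemma mpoly_nonroot (f : {mpoly K[n]}) : f != 0 ->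
  exists2 v : 'I_n -> K, (forall i, v i != 0) & f.@[v] != 0.
Proof.
move=> f0; pose b := msize f.
pose code (m : 'X_{1..n}) := (\sum_(i < n) m i * b ^ i)%N.
pose p := \sum_(m <- msupp f) f@_m *: 'X^(code m).
have lt_b m i : m \in msupp f -> (m i < b)%N.
  move/msize_mdeg_lt; apply: leq_ltn_trans.
  by rewrite mdegE (bigD1 i) //= leq_addr.
have code_inj m1 m2 : m1 \in msupp f -> m2 \in msupp f -> code m1 = code m2 -> m1 = m2.
  move=> h1 h2 /digits_inj h; apply/mnmP => i; apply: h => j; exact: lt_b.
have p0 : p != 0.
  apply/eqP => p0; have mf := mlead_supp f0.
  move: (congr1 (fun q : {poly K} => q`_(code (mlead f))) p0).
  rewrite coef0 coef_sum (bigD1_seq (mlead f)) ?msupp_uniq //= big_seq_cond big1.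
    by rewrite addr0 coefZ coefXn eqxx mulr1 => /eqP; rewrite (mcoeff_eq0 f) mf.
  move=> m /andP[hm mne]; rewrite coefZ coefXn.
  case: eqP => [e|_]; last by rewrite mulr0.
  by rewrite (code_inj _ _ mf hm e) eqxx in mne.
have [x x0 px] := poly_nonroot p0.
exists (fun i => x ^+ (b ^ i)) => [i|]; first exact: expf_neq0.
rewrite mevalE; move: px; rewrite /p horner_sum.
congr (_ != 0); apply: eq_bigr => m _.
rewrite hornerZ hornerXn /code -prodrXr; congr (_ * _).
by apply: eq_bigr => i _; rewrite mulnC exprM.
Qed.

End Nonvanishing.

(** * Adapted coordinates and vanishing ideals of subspaces *)

Section Subspace.
Variables (K : closedFieldType) (n : nat).
Hypothesis charK : [pchar K] =i pred0.
Implicit Types (V : {vspace 'rV[K]_n.+1}) (g : 'M[K]_n.+1).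

Definition adapted c V g := g \in unitmx /\
  forall y : 'rV[K]_n.+1,
    y *m g \in V <-> forall i : 'I_n.+1, (i < c)%N -> y 0 i = 0.

(** The rows of [g] are a basis of a complement of [V] followed by a basis of [V]. *)
Lemma exists_adapted r V : \dim V = r.+1 -> exists g, adapted (n - r) V g.
Proof.
move=> dimV.
have dimVC : \dim (V^C) = (n - r)%N.
  have := dimv_compl V; rewrite dimvf /dim /= mul1n dimV => ->.
  by rewrite subSS.
have rn : (r <= n)%N.
  by have := dimvS (subvf V); rewrite dimV dimvf /dim /= mul1n.
pose X := vbasis V^C ++ vbasis V.
have szX : size X = n.+1 by rewrite size_cat !size_tuple dimV dimVC addnS subnK.
have freeX : free (Tuple (introT eqP szX)).
  rewrite cat_free !(basis_free (vbasisP _)) /=.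
  rewrite !(span_basis (vbasisP _)); apply/directv_addP.
  by rewrite capvC capv_compl.
have freeXP (k : 'I_n.+1 -> K) : \sum_i k i *: X`_i = 0 -> forall i, k i = 0.
  exact: (freeP freeX).
pose g : 'M[K]_n.+1 := \matrix_i X`_i.
have gE (y : 'rV[K]_n.+1) : y *m g = \sum_i y 0 i *: X`_i.
  by rewrite mulmx_sum_row; apply: eq_bigr => i _; rewrite rowK.
have gU : g \in unitmx.
  rewrite -row_free_unit; apply: inj_row_free => y; rewrite gE => y0.
  by apply/rowP => i; rewrite mxE; exact: (freeXP (fun i => y 0 i) y0).
have XVC (i : 'I_n.+1) : (i < n - r)%N -> X`_i \in (V^C)%VS.
  rewrite -dimVC => ic; rewrite nth_cat size_tuple ic.
  by apply: vbasis_mem; rewrite mem_nth // size_tuple.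
have XV (i : 'I_n.+1) : ~~ (i < n - r)%N -> X`_i \in V.
  rewrite -dimVC -leqNgt => ic; rewrite nth_cat size_tuple ltnNge ic.
  apply: vbasis_mem; rewrite mem_nth // size_tuple ltn_subLR //.
  by rewrite dimVC dimV addnS subnK.
exists g; split=> // y; split=> [yV i ic|y0]; last first.
  rewrite gE; apply: rpred_sum => i _.
  have [ic|ic] := boolP (i < n - r)%N; first by rewrite y0 // scale0r rpred0.
  by apply: rpredZ; apply: XV.
(* The component of [y *m g] in the complement; it also lies in [V], so it is zero, and freeness
   kills its coefficients. *)
pose u := \sum_(i < n.+1 | (i < n - r)%N) y 0 i *: X`_i.
have u0 : u = 0.
  have : u \in (V :&: V^C)%VS; last by rewrite capv_compl memv0 => /eqP.
  rewrite memv_cap; apply/andP; split; last first.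
    by apply: rpred_sum => j jc; apply: rpredZ; apply: XVC.
  have -> : u = y *m g - \sum_(i < n.+1 | ~~ (i < n - r)%N) y 0 i *: X`_i.
    by rewrite gE (bigID (fun i : 'I_n.+1 => (i < n - r)%N)) /= addrK.
  apply: rpredB => //; apply: rpred_sum => j jc.
  by apply: rpredZ; apply: XV.
have := freeXP (fun i => if (i < n - r)%N then y 0 i else 0).
move=> /(_ _ i); rewrite ic; apply.
rewrite -[RHS]u0 /u [RHS]big_mkcond; apply: eq_bigr => j _ /=.
by case: ifP => // _; rewrite scale0r.
Qed.

(** Monomials of positive partial degree vanish on [V]. Conversely, if the part of partial degree 0
    is nonzero, a point where it does not vanish, with its first [c] coordinates set to 0,
    contradicts vanishing on [V]. *)
Lemma vanishing_ideal_fat c V g : adapted c V g -> (c <= n)%N ->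
  vanishing_ideal (proj_space V) = fat_ideal g c 1.
Proof.
move=> [gU gV] cn; apply/seteqP; split=> f hf; last first.
  move=> v [_ vV]; pose y := v *m invmx g.
  have vE : v = y *m g by rewrite mulmxKV.
  rewrite vE -meval_coord mevalE big1_seq // => m _.
  have [mc|mc] := posnP (ldeg c m); first by rewrite hf ?mc // mul0r.
  have [i ic mi] := ldeg_gt0 mc.
  rewrite (bigD1 i) //= (proj1 (gV y)) -?vE // expr0n.
  by rewrite eqn0Ngt mi /= mul0r mulr0.
apply/fat_idealE => -[|//] _; set h := f \mPo _.
apply/eqP; apply: contraT => h0.
have [v v0 hv] := mpoly_nonroot charK h0.
pose y : 'rV[K]_n.+1 := \row_i (if (i < c)%N then 0 else v i).
have yV : y *m g \in V by apply/gV => i ic; rewrite mxE ic.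
(* Since [c <= n], the last coordinate is not erased, and [v] has no zero coordinate. *)
have y0 : y != 0.
  apply/eqP => /rowP /(_ ord_max); rewrite !mxE /= ltnNge cn /= => /eqP.
  by rewrite (negbTE (v0 _)).
have yg0 : y *m g != 0.
  by apply: contra y0 => /eqP yg; rewrite -[y](mulmxK gU) yg mul0mx.
have hE : h.@[y 0] = ((mark c h)`_0).@[v].
  rewrite [h in LHS]mpolyE [h in RHS]mpolyE !raddf_sum coef_sum raddf_sum.
  apply: eq_bigr => m _ /=; rewrite mevalZ markZ markX !coefCM coefXn mevalM mevalC.
  rewrite mevalM !mevalX; congr (_ * _).
  rewrite rmorph_nat; have [m0|mc] := posnP (ldeg c m).
    rewrite m0 eqxx mulr1; apply: eq_bigr => i _; rewrite mxE.
    case: ifP => // ic; have /eqP := m0.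
    by rewrite /ldeg (bigD1 i) //= addn_eq0 => /andP[/eqP -> _]; rewrite !expr0.
  rewrite eq_sym eqn0Ngt mc /= mulr0.
  have [i ic mi] := ldeg_gt0 mc.
  by rewrite (bigD1 i) //= mxE ic expr0n eqn0Ngt mi /= mul0r.
by move: hv; rewrite -hE meval_coord hf ?eqxx //; split.
Qed.

(* Decomposes the coordinate functions along the projection onto [V] parallel to
   [U]. *)
Lemma split_linear_form (U V : {vspace 'rV[K]_n.+1}) k : (U :&: V = 0)%VS ->
  exists a b : {mpoly K[n.+1]}, [/\ 'X_k = a + b, a \is 1.-homog, b \is 1.-homog,
    vanishing_ideal (proj_space U) a & vanishing_ideal (proj_space V) b].
Proof.
move=> UV; have VU : (V :&: U = 0)%VS by rewrite capvC.
pose a : {mpoly K[n.+1]} := \sum_j daddv_pi V U (delta_mx 0 j) 0 k *: 'X_j.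
have aE (v : 'rV[K]_n.+1) : a.@[v 0] = daddv_pi V U v 0 k.
  rewrite [in RHS](row_sum_delta v) [in RHS]linear_sum summxE /a raddf_sum /=.
  by apply: eq_bigr => j _; rewrite mevalZ mevalXU linearZ mxE mulrC.
have ha : a \is 1.-homog.
  by apply: rpred_sum => j _; apply: rpredZ; rewrite dhomogX /= mdeg1.
exists a, ('X_k - a); split=> //.
- by rewrite addrC subrK.
- by apply: rpredB => //; rewrite dhomogX /= mdeg1.
- move=> v [_ vU]; rewrite aE.
  have /eqP := daddv_pi_add UV (subvP (addvSl U V) _ vU).
  by rewrite daddv_pi_id // addrC -subr_eq0 addrK => /eqP ->; rewrite mxE.
- by move=> v [_ vV]; rewrite mevalB mevalXU aE daddv_pi_id // subrr.
Qed.

End Subspace.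

(** * Comaximality *)

Section ComaximalPowers.
Variables (K : fieldType) (n : nat).
Implicit Types (I J : set {mpoly K[n]}) (m : 'X_{1..n}).

(** Comaximality up to the irrelevant ideal. Summands of degree 1 keep all later decompositions
    homogeneous. *)
Definition linearly_comaximal I J := forall k, exists a b : {mpoly K[n]},
  [/\ 'X_k = a + b, a \is 1.-homog, b \is 1.-homog, I a & J b].

Lemma mnm_pos m : (0 < mdeg m)%N -> exists k m', m = (U_(k) + m')%MM.
Proof.
move=> hm; have [|k _ mk] := @ldeg_gt0 n n m.
  by rewrite /ldeg (eq_bigl xpredT) -?mdegE // => i; rewrite ltn_ord.
by exists k, (m - U_(k))%MM; apply: addm_mnm1.
Qed.

Lemma mnm_split m d : (d <= mdeg m)%N -> exists m1 m2, m = (m1 + m2)%MM /\ mdeg m1 = d.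
Proof.
elim: d => [|d IHd] hd; first by exists 0%MM, m; rewrite add0m mdeg0.
have [m1 [m2 [mE m1d]]] := IHd (ltnW hd).
have [|k [m' m2E]] := @mnm_pos m2; first by move: hd; rewrite mE mdegD; lia.
exists (m1 + U_(k))%MM, m'; rewrite mE m2E addmA; split=> //.
by rewrite mdegD m1d mdeg1 addn1.
Qed.

(** With ['X_k = a + b] a variable of the monomial, decompose the remaining monomial twice: for one
    power of [I] less, to be multiplied by [a], and for one power of [J] less, to be multiplied by
    [b]. *)
Lemma monomial_pow_sum I J p q m : linearly_comaximal I J -> (p + q <= mdeg m)%N ->
  exists b c, [/\ 'X_[m] = b + c, b \is (mdeg m).-homog, c \is (mdeg m).-homog,
    ideal_pow I p b & ideal_pow J q c].
Proof.
move=> IJ; have [e] := ubnP (p + q)%N; elim: e p q m => // e IHe p q m he hm.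
case: p q => [|p] [|q] in he hm *.
- exists 'X_[m], 0; rewrite addr0 dhomogX rpred0; split=> //; exact: ideal_pow0.
- exists 'X_[m], 0; rewrite addr0 dhomogX rpred0; split=> //; first exact: ideal_pow0.
  by case: (ideal_pow_ideal J q.+1).
- exists 0, 'X_[m]; rewrite add0r dhomogX rpred0; split=> //; last exact: ideal_pow0.
  by case: (ideal_pow_ideal I p.+1).
have [|k [m' mE]] := @mnm_pos m; first by lia.
have dm : mdeg m = (1 + mdeg m')%N by rewrite mE mdegD mdeg1.
have [a [b [kE ha hb Ia Jb]]] := IJ k.
have [||b1 [c1 [E1 hb1 hc1 Ib1 Jc1]]] := IHe p q.+1 m'; [lia|lia|].
have [||b2 [c2 [E2 hb2 hc2 Ib2 Jc2]]] := IHe p.+1 q m'; [lia|lia|].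
have [_ ID IM] := ideal_pow_ideal I p.+1; have [_ JD JM] := ideal_pow_ideal J q.+1.
exists (a * b1 + b * b2), (a * c1 + b * c2); rewrite dm; split.
- by rewrite mE mpolyXD kE mulrDl addrACA -!mulrDr -E1 -E2.
- by apply: rpredD; apply: dhomogM.
- by apply: rpredD; apply: dhomogM.
- by apply: ID; [apply: ideal_powS|apply: IM].
- by apply: JD; [apply: JM|apply: ideal_powS].
Qed.

(** Each [j] in [s] uses a factor of degree [p + p], split between the powers of [Q j] and [Q i].
    The product of the [Q j] parts is [b]; every other term lies in the power of [Q i]. *)
Lemma monomial_bigcap_sum (T : eqType) (Q : T -> set {mpoly K[n]}) i p s m :
  (forall j, j != i -> linearly_comaximal (Q j) (Q i)) ->
  i \notin s -> ((p + p) * size s <= mdeg m)%N ->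
  exists b c, [/\ 'X_[m] = b + c, b \is (mdeg m).-homog, c \is (mdeg m).-homog,
    forall j, j \in s -> ideal_pow (Q j) p b & ideal_pow (Q i) p c].
Proof.
move=> hQ; elim: s m => [|j s IHs] m.
  move=> _ _; exists 'X_[m], 0; rewrite addr0 dhomogX rpred0; split=> //.
  by case: (ideal_pow_ideal (Q i) p).
rewrite inE negb_or eq_sym => /andP[ji si] /=; rewrite mulnS => hm.
have [|m1 [m2 [mE d1]]] := @mnm_split m (p + p); first by lia.
have dm : mdeg m = (mdeg m1 + mdeg m2)%N by rewrite mE mdegD.
have [|b1 [c1 [E1 hb1 hc1 Qb1 Qc1]]] := @monomial_pow_sum (Q j) (Q i) p p m1 (hQ j ji).
  by rewrite d1.
have [||b2 [c2 [E2 hb2 hc2 Qb2 Qc2]]] := IHs m2; [by []|lia|].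
have [_ QD QM] := ideal_pow_ideal (Q i) p.
exists (b1 * b2), (b1 * c2 + c1 * 'X_[m2]); rewrite dm; split.
- by rewrite addrA -mulrDr -E2 -mulrDl -E1 mE mpolyXD.
- exact: dhomogM.
- apply: rpredD; apply: dhomogM => //; by rewrite dhomogX.
- move=> l; rewrite inE => /orP[/eqP->|ls].
    by rewrite mulrC; case: (ideal_pow_ideal (Q j) p) => _ _; apply.
  by case: (ideal_pow_ideal (Q l) p) => _ _; apply; apply: Qb2.
- by apply: QD; [apply: QM|rewrite mulrC; apply: QM].
Qed.

Lemma dhomog_bigcap_sum (T : eqType) (Q : T -> set {mpoly K[n]}) i p s t f :
  (forall j, j != i -> linearly_comaximal (Q j) (Q i)) ->
  i \notin s -> ((p + p) * size s <= t)%N -> f \is t.-homog ->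
  exists b c, [/\ f = b + c, b \is t.-homog, c \is t.-homog,
    forall j, j \in s -> ideal_pow (Q j) p b & ideal_pow (Q i) p c].
Proof.
move=> hQ si ht /dhomogP hf; rewrite [f]mpolyE big_seq.
have [Q0 QD QM] := ideal_pow_ideal (Q i) p.
pose R (h : {mpoly K[n]}) := exists b c, [/\ h = b + c, b \is t.-homog, c \is t.-homog,
    forall j, j \in s -> ideal_pow (Q j) p b & ideal_pow (Q i) p c].
apply: (big_ind R) => [|_ _ [b1 [c1 [-> hb1 hc1 Qb1 Qc1]]]
    [b2 [c2 [-> hb2 hc2 Qb2 Qc2]]]|m /hf].
- exists 0, 0; rewrite addr0 rpred0; split=> // j _.
  by case: (ideal_pow_ideal (Q j) p).
- exists (b1 + b2), (c1 + c2); rewrite addrACA; split; [by []|exact: rpredD|exact: rpredD| |].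
    move=> j js; case: (ideal_pow_ideal (Q j) p) => _ jD _.
    by apply: jD; [apply: Qb1|apply: Qb2].
  exact: QD.
move=> /= mt; have [|b [c [E hb hc Qb Qc]]] := @monomial_bigcap_sum T Q i p s m hQ si.
  by rewrite mt.
rewrite mt in hb hc; exists (f@_m *: b), (f@_m *: c).
rewrite E scalerDr; split; [by []|exact: rpredZ|exact: rpredZ| |].
  move=> j js; rewrite -mul_mpolyC; case: (ideal_pow_ideal (Q j) p) => _ _.
  by apply; apply: Qb.
by rewrite -mul_mpolyC; apply: QM.
Qed.

End ComaximalPowers.

(** * Hilbert functions *)

Section LowMonomials.
Variable n : nat.

Definition low_monomials c k t : seq 'X_{1..n} :=
  [seq [multinom nth 0%N x i | i < n] | x <- low_comps c k n t].

Lemma sumn_take c (x : seq nat) :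
  sumn (take c x) = (\sum_(i < size x | (i < c)%N) nth 0%N x i)%N.
Proof.
elim: x c => [|a x IHx] [|c]; [by rewrite big_ord0|by rewrite big_ord0|by rewrite big_pred0|].
rewrite /= IHx.
by rewrite [in RHS]big_mkcond big_ord_recl /= -big_mkcond.
Qed.

Lemma low_monomialsP c k t m :
  (m \in low_monomials c k t) = (mdeg m == t) && (ldeg c m < k)%N.
Proof.
have seqE x : size x = n ->
    (mdeg [multinom nth 0%N x i | i < n] = sumn x) *
    (ldeg c [multinom nth 0%N x i | i < n] = sumn (take c x)).
  move=> sx; split.
    rewrite mdegE -[x in RHS]take_size sumn_take sx.
    by apply: eq_big => [i|i _]; rewrite ?ltn_ord ?mnmE.
  by rewrite sumn_take sx; apply: eq_bigr => i _; rewrite mnmE.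
apply/mapP/idP => [[x + ->]|/andP[/eqP mt mk]].
  rewrite mem_filter mem_comps => /and3P[xk /eqP xn xt].
  by rewrite !seqE // xt.
pose x := [seq m i | i <- enum 'I_n].
have xn : size x = n by rewrite size_map size_enum_ord.
have mE : m = [multinom nth 0%N x i | i < n].
  apply/mnmP => i; rewrite mnmE (nth_map i) ?size_enum_ord //.
  by rewrite nth_ord_enum.
exists x => //; rewrite mem_filter mem_comps xn eqxx /=.
by move: mt mk; rewrite {1 2}mE !seqE // => -> ->; rewrite eqxx.
Qed.

Lemma low_monomials_uniq c k t : uniq (low_monomials c k t).
Proof.
rewrite map_inj_in_uniq ?filter_uniq ?comps_uniq // => x y.
rewrite !mem_filter !mem_comps => /and3P[_ /eqP sx _] /and3P[_ /eqP sy _] E.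
apply: (@eq_from_nth _ 0%N); first by rewrite sx sy.
move=> i; rewrite sx => ilt.
by move/mnmP: E => /(_ (Ordinal ilt)); rewrite !mnmE.
Qed.

End LowMonomials.

Section HilbertFunction.
Variables (K : closedFieldType) (n : nat).

(** Rank-nullity for the map sending a form to its coefficients at the low monomials in adapted
    coordinates: the kernel is the graded piece, and the map is onto. *)
Lemma exists_fat_piece (g : 'M[K]_n.+1) c k t : g \in unitmx ->
  exists U : {vspace dhomog n.+1 K t},
    (forall f : dhomog n.+1 K t, f \in U <-> fat_ideal g c k (f : {mpoly K[n.+1]})) /\
    (\dim U + size (low_comps c k n.+1 t) = \dim {: dhomog n.+1 K t})%N.
Proof.
move=> gU; pose l := low_monomials n.+1 c k t.
pose F (f : dhomog n.+1 K t) : 'rV[K]_(size l) :=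
  \row_i ((f : {mpoly K[n.+1]}) \mPo coord_tuple g)@_(nth 0%MM l i).
have Flin : linear F.
  move=> a f1 f2; apply/rowP => i.
  by rewrite !mxE /= comp_mpolyD comp_mpolyZ mcoeffD mcoeffZ.
pose FL := GRing.isLinear.Build _ _ _ _ F Flin.
pose G : {linear dhomog n.+1 K t -> 'rV[K]_(size l)} := HB.pack F FL.
have GE f : linfun G f = F f by rewrite lfunE.
exists (lker (linfun G)); split=> [f|].
  rewrite memv_ker GE; split=> [/eqP/rowP f0 m mk|f0]; last first.
    apply/eqP/rowP => i; rewrite !mxE f0 //.
    have : nth 0%MM l i \in l by rewrite mem_nth.
    by rewrite low_monomialsP => /andP[].
  have [mt|mt] := eqVneq (mdeg m) t; last first.
    have ft : (f : {mpoly K[n.+1]}) \mPo coord_tuple g \is t.-homog.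
      by apply: dhomog_coord; case: f {f0}.
    exact: dhomog_nemf_coeff ft mt.
  have ml : m \in l by rewrite low_monomialsP mt eqxx.
  have mi : (index m l < size l)%N by rewrite index_mem.
  by have := f0 (Ordinal mi); rewrite !mxE /= nth_index.
have -> : size (low_comps c k n.+1 t) = \dim (limg (linfun G)).
  suff -> : limg (linfun G) = fullv by rewrite dimvf /dim /= mul1n size_map.
  apply/eqP; rewrite eqEsubv subvf; apply/subvP => y _.
  (* A preimage of [y]: this combination of low monomials, carried back by [invmx g]. *)
  pose h : {mpoly K[n.+1]} := \sum_(i < size l) y 0 i *: 'X_[nth 0%MM l i].
  have hh : h \is t.-homog.
    apply: rpred_sum => i _; apply: rpredZ; rewrite dhomogX /=.
    have : nth 0%MM l i \in l by rewrite mem_nth.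
    by rewrite low_monomialsP => /andP[].
  have -> : y = linfun G (DHomog (dhomog_coord (invmx g) hh)); last first.
    by rewrite memv_img ?memvf.
  rewrite GE; apply/rowP => j; rewrite mxE /= coordKV // raddf_sum (bigD1 j) //=.
  rewrite mcoeffZ mcoeffX eqxx mulr1 big1 ?addr0 // => i ij.
  rewrite mcoeffZ mcoeffX nth_uniq ?low_monomials_uniq //.
  by rewrite (inj_eq val_inj) (negbTE ij) mulr0.
by rewrite -(limg_ker_dim (linfun G) fullv) capfv.
Qed.

(** In degrees [t >= (k + k) * s], each piece and the intersection of the others together span all
    forms, so codimensions add. *)
Lemma hilbert_fun_bigcap s (g : 'I_s -> 'M[K]_n.+1) c k t :
  (forall i, g i \in unitmx) ->
  (forall i j, i != j ->
     linearly_comaximal (fat_ideal (g i) c 1) (fat_ideal (g j) c 1)) ->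
  ((k + k) * s <= t)%N ->
  hilbert_fun [set f | forall i, fat_ideal (g i) c k f] t =
    (s * size (low_comps c k n.+1 t))%N.
Proof.
move=> gU comax kst.
have /choice[U hU] := fun i => exists_fat_piece c k t (gU i).
have capP (l : seq 'I_s) (f : dhomog n.+1 K t) : f \in (\bigcap_(i <- l) U i)%VS <->
    forall i, i \in l -> fat_ideal (g i) c k (f : {mpoly K[n.+1]}).
  elim: l => [|i l IHl]; first by rewrite big_nil memvf.
  rewrite big_cons memv_cap; split=> [/andP[fi /IHl fl] j|hl].
    by rewrite inE => /orP[/eqP->|/fl //]; apply/(proj1 (hU i)).
  apply/andP; split; first by apply/(proj1 (hU i))/hl; rewrite mem_head.
  by apply/IHl => j jl; apply: hl; rewrite inE jl orbT.
have dimP (l : seq 'I_s) : uniq l -> (\dim (\bigcap_(i <- l) U i) +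
    size l * size (low_comps c k n.+1 t) = \dim {: dhomog n.+1 K t})%N.
  elim: l => [|i l IHl]; first by rewrite big_nil addn0.
  rewrite cons_uniq => /andP[il ul].
  have full : (U i + \bigcap_(j <- l) U j)%VS = fullv.
    apply/eqP; rewrite eqEsubv subvf; apply/subvP => f _.
    have [|||b [cc [fE hb hc Qb Qc]]] := @dhomog_bigcap_sum K n.+1 _
        (fun i => fat_ideal (g i) c 1) i k l t (f : {mpoly K[n.+1]}) _ il.
    - by move=> j ji; apply: comax.
    - apply: leq_trans kst; rewrite leq_mul2l; apply/orP; right.
      by have := uniq_leq_size ul (fun j _ => mem_enum 'I_s j); rewrite size_enum_ord.
    - by case: (f).
    have -> : f = DHomog hc + DHomog hb by apply: val_inj; rewrite /= fE addrC.
    apply: memv_add.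
      by apply/(proj1 (hU i)); rewrite fat_ideal_pow.
    by apply/capP => j jl; rewrite fat_ideal_pow //; apply: Qb.
  have := dimv_sum_cap (U i) (\bigcap_(j <- l) U j)%VS.
  rewrite full big_cons /= mulSn; have := IHl ul; have := proj2 (hU i); lia.
have -> : hilbert_fun [set f | forall i, fat_ideal (g i) c k f] t =
    (\dim {: dhomog n.+1 K t} - \dim (\bigcap_(i <- enum 'I_s) U i))%N.
  congr (_ - \dim _)%N; rewrite /graded_piece.
  (* The intersection satisfies the specification of [graded_piece], so [xget] does not fall back to
     its default and returns the same subspace. *)
  set P := [set W | _]; have PW : P (\bigcap_(i <- enum 'I_s) U i)%VS.
    move=> f; rewrite capP; split=> hf i; last by move=> _; apply: hf.
    by apply: hf; rewrite mem_enum.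
  have := @xgetPex _ 0%VS P (ex_intro _ _ PW); move=> Pg.
  apply/vspaceP => f; apply/idP/idP => hf.
    by apply/(PW f)/(Pg f).
  by apply/(Pg f)/(PW f).
have := dimP (enum 'I_s) (enum_uniq _); rewrite size_enum_ord => <-.
by rewrite addKn.
Qed.

End HilbertFunction.

(** * Asymptotics *)

Lemma cvg_horner (R : realType) (p : {poly R}) (u : R ^nat) (a : R) :
  u @ \oo --> a -> (fun m => p.[u m]) @ \oo --> p.[a].
Proof.
move=> ua; elim/poly_ind: p => [|p c IHp].
  by under eq_fun do rewrite horner0; rewrite horner0; apply: cvg_cst.
under eq_fun do rewrite hornerMXaddC; rewrite hornerMXaddC.
by apply: cvgD; [apply: cvgM|apply: cvg_cst].
Qed.

(* With [q] the reversal of [p], [p.[m] / m^n = q.[1/m]]. *)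
Lemma cvg_lead_coef (R : realType) (p : {poly R}) n : (size p <= n.+1)%N ->
  (fun m : nat => p.[m%:R] / m%:R ^+ n) @ \oo --> p`_n.
Proof.
move=> sp; rewrite -cvg_shiftS; pose q := \poly_(i < n.+1) p`_(n - i).
have q0 : q.[0] = p`_n by rewrite horner_coef0 coef_poly subn0.
rewrite -q0; have := cvg_horner (p := q) (@cvg_harmonic R).
apply: cvg_trans; apply: near_eq_cvg; near=> m => /=.
have m0 : m.+1%:R != 0 :> R by rewrite pnatr_eq0.
rewrite horner_poly (horner_coef_wide _ sp) mulr_suml.
rewrite [RHS](reindex_inj rev_ord_inj); apply: eq_bigr => i _ /=.
have ni : (i <= n)%N by rewrite -ltnS.
rewrite subSS -mulrA; congr (_ * _).
rewrite exprVn -[X in _ / _ ^+ X](subnK ni) exprD invfM mulrA mulfV ?mul1r //.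
by rewrite expf_neq0.
Unshelve. all: by end_near. Qed.

Lemma natr_rat_inj : injective (fun i : nat => i%:R : rat).
Proof. by move=> i j /eqP; rewrite eqr_nat => /eqP. Qed.

Lemma natr_poly_rat_inj : injective (fun i : nat => i%:R : {poly rat}).
Proof.
move=> i j /=; rewrite -!(polyC_natr rat) => /polyC_inj; exact: natr_rat_inj.
Qed.

Lemma hilbert_polyE (K : closedFieldType) n (J : set {mpoly K[n.+1]}) p :
  is_hilbert_poly J p -> hilbert_poly J = p.
Proof.
move=> hp; have [N' hN'] := xgetPex 0 (ex_intro _ _ hp : exists q, is_hilbert_poly J q).
have [N hN] := hp; apply: (@poly_eq_nat _ _ _ (maxn N N') natr_rat_inj) => m.
by rewrite geq_max => /andP[h h']; rewrite hN // hN'.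
Qed.

(** * Hilbert polynomials and [P] for disjoint subspaces *)

Section Configuration.
Variables (K : closedFieldType) (n r s : nat).
Hypothesis charK : [pchar K] =i pred0.
Variable V : 'I_s -> {vspace 'rV[K]_n.+1}.
Hypothesis hV : disjoint_subspaces r V.

Lemma disjoint_subspaces_cap i j : i != j -> (V i :&: V j = 0)%VS.
Proof.
move=> ij; apply/eqP; rewrite -subv0; apply/subvP => v; rewrite memv_cap memv0.
move=> /andP[vi vj]; apply: contraT => v0; case/eqP: ij.
by apply: (proj2 hV) => //; exists v.
Qed.

Lemma dim_disjoint_subspaces : (0 < s)%N -> (r <= n)%N.
Proof.
move=> s0; have := dimvS (subvf (V (Ordinal s0))).
by rewrite (proj1 hV) dimvf /dim /= mul1n.
Qed.

Lemma symbolic_power_subspaces : exists g : 'I_s -> 'M[K]_n.+1,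
  [/\ forall i, g i \in unitmx,
      forall i j, i != j -> linearly_comaximal (fat_ideal (g i) (n - r) 1)
                                               (fat_ideal (g j) (n - r) 1) &
      forall m, symbolic_power (subspaces_ideal V) m =
                [set f | forall i, fat_ideal (g i) (n - r) m f]].
Proof.
have /choice[g hg] : forall i, exists g, adapted (n - r) (V i) g.
  by move=> i; apply: exists_adapted; apply: (proj1 hV).
have gU i : g i \in unitmx by case: (hg i).
have QE i : vanishing_ideal (proj_space (V i)) = fat_ideal (g i) (n - r) 1.
  by apply: vanishing_ideal_fat (hg i) _ => //; apply: leq_subr.
have comax i j : i != j -> linearly_comaximal (fat_ideal (g i) (n - r) 1)
                                              (fat_ideal (g j) (n - r) 1).
  move=> ij k; rewrite -!QE.
  exact: split_linear_form (disjoint_subspaces_cap ij).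
exists g; split=> // m.
have -> : subspaces_ideal V = [set f | forall i, fat_ideal (g i) (n - r) 1 f].
  apply/seteqP; split=> f hf.
    by move=> i; rewrite -QE => v hv; apply: hf; exists i.
  by move=> v [i _ hv]; have := hf i; rewrite -QE; apply.
rewrite symbolic_power_bigcap.
- by apply/seteqP; split=> f hf i; have := hf i; rewrite (fat_ideal_pow _ m (gU i)).
- by move=> i; apply: is_prime_fat.
(* If [Q j] were contained in [Q i], comaximality would put every variable in [Q i], but [V i]
   contains a nonzero vector. *)
- move=> i j ij; apply: contrapT => h.
  have hX k : fat_ideal (g i) (n - r) 1 'X_k.
    have [a [b [-> _ _ ha hb]]] := comax i j ij k.
    case: (is_ideal_fat (g i) (n - r) 1) => _ hD _; apply: hD; first exact: ha.
    by apply: contrapT => nb; apply: h; exists b.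
  have [v vV v0] : exists2 v, v \in V i & v != 0.
    exists (vpick (V i)); first exact: memv_pick.
    by rewrite vpick0 -dimv_eq0 (proj1 hV).
  case/eqP: v0; apply/rowP => k; rewrite mxE; apply: contrapT => /eqP vk.
  have := hX k; rewrite -QE => /(_ v); rewrite mevalXU => hv.
  have v0 : v != 0 by apply: contra vk => /eqP ->; rewrite mxE.
  by move: vk; rewrite hv ?eqxx.
- by move=> i a b; rewrite -(fat_ideal_pow _ m (gU i)); apply: fat_ideal_primary.
Qed.

Lemma hilbert_poly_symbolic m : (0 < m)%N ->
  hilbert_poly (symbolic_power (subspaces_ideal V) m) = fat_hilbert n r s m.
Proof.
move=> m0; have [g [gU comax symE]] := symbolic_power_subspaces.
(* The bound [m] serves the monomial count, and [(m + m) * s] the additivity of codimensions. *)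
apply: hilbert_polyE; exists (maxn m ((m + m) * s)) => t.
rewrite geq_max => /andP[mt mst]; rewrite symE hilbert_fun_bigcap //.
have [s0|s0] := posnP s; last by rewrite horner_fat_hilbert ?dim_disjoint_subspaces.
by rewrite /fat_hilbert s0 mul0n scale0r horner0.
Qed.

Definition P_in_m_poly : {poly {poly rat}} := binomial_in_m n - fat_hilbert_in_m n r s.

Lemma binomial_in_mE (m : nat) :
  (binomial_in_m n).[m%:R] = binomial_poly n \Po (m%:R *: 'X).
Proof.
rewrite /binomial_in_m horner_rising_poly.
have -> : binomial_poly n = rising n 'X by [].
rewrite comp_rising comp_polyX hornerM hornerX hornerC -mul_polyC.
by rewrite polyC_natr.
Qed.

Lemma P_in_m_polyP : P_in_m (subspaces_ideal V) P_in_m_poly.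
Proof.
move=> m m0; rewrite /P_poly hilbert_poly_symbolic // comp_polyB.
by rewrite hornerD hornerN binomial_in_mE fat_hilbert_in_mE.
Qed.

Lemma bideg_binomial_in_m : bideg_le n n (binomial_in_m n).
Proof.
rewrite -{1 2}[n]muln1; apply: bideg_le_rising.
apply: (@bideg_leM 1 0 0 1); first exact: bideg_leX.
by apply: bideg_leC; rewrite size_polyX.
Qed.

(** The top power of [m] arises only by choosing the term [m t] in all [n] factors. *)
Lemma coef_binomial_in_m : (binomial_in_m n)`_n = (n`!%:R)^-1 *: 'X^n.
Proof.
rewrite /binomial_in_m /rising_poly coefCM -mul_polyC; congr (_ * _).
pose F k : {poly {poly rat}} := \prod_(i < k) ('X * 'X%:P + i.+1%:R).
suff h k : (F k)`_k = 'X^k /\ (size (F k) <= k.+1)%N by case: (h n).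
elim: k => [|k [IHk IHs]]; first by rewrite /F big_ord0 coef1 size_poly1 expr0.
have pE : F k.+1 = F k * 'X%:P * 'X + F k * (k.+1%:R)%:P.
  by rewrite /F big_ord_recr /= mulrDr ['X * _]mulrC mulrA polyC_natr.
split; last first.
  rewrite pE; apply: leq_trans (size_polyD _ _) _; rewrite geq_max.
  have szC (c : {poly rat}) : (size (F k * c%:P)%R <= k.+1)%N.
    by rewrite mulrC mul_polyC; apply: leq_trans (size_scale_leq _ _) IHs.
  rewrite (leq_trans (szC _)) // andbT.
  by apply: leq_trans (size_polyMleq _ _) _; rewrite size_polyX addn2 ltnS szC.
rewrite pE coefD coefMX /= coefMC IHk coefMC nth_default ?mul0r ?addr0 //.
by rewrite exprSr.
Qed.

(** Two copies of the whole space would meet, so [s = 1]. The bound on the degree in zero variables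
    is vacuous, so all monomials are counted. *)
Lemma fat_hilbert_full : r = n -> (0 < s)%N -> binomial_in_m n = fat_hilbert_in_m n r s.
Proof.
move=> rn s0; have s1 : s = 1%N.
  apply/eqP; rewrite eqn_leq s0 andbT leqNgt; apply/negP => s1.
  have ij : Ordinal s0 != Ordinal s1 by [].
  have := dimv_sum_cap (V (Ordinal s0)) (V (Ordinal s1)).
  rewrite disjoint_subspaces_cap // dimv0 addn0 !(proj1 hV) rn => h.
  have := dimvS (subvf (V (Ordinal s0) + V (Ordinal s1))%VS).
  by rewrite h dimvf /dim /= mul1n; lia.
apply: (@poly_eq_nat _ _ _ 1 natr_poly_rat_inj) => m m0.
rewrite binomial_in_mE fat_hilbert_in_mE //; congr (_ \Po _).
apply: (@poly_eq_nat _ _ _ m natr_rat_inj) => t mt.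
rewrite horner_fat_hilbert ?rn // s1 mul1n subnn -[m in low_comps _ m](prednK m0).
rewrite size_low_comps0 size_comps bin_rising.
have -> : binomial_poly n = rising n 'X by [].
by rewrite horner_rising hornerX.
Qed.

Lemma lead_coef_P_in_m : lead_coef P_in_m_poly = P_in_m_poly`_n.
Proof.
have n0 : ((n`!%:R)^-1 : rat) != 0 by rewrite invr_eq0 pnatr_eq0 -lt0n fact_gt0.
have lead (p : {poly {poly rat}}) : (size p <= n.+1)%N -> p`_n != 0 -> lead_coef p = p`_n.
  move=> sp pn; rewrite lead_coefE; suff -> : size p = n.+1 by [].
  apply/eqP; rewrite eqn_leq sp ltnNge; apply/negP => sp'.
  by rewrite nth_default ?eqxx in pn.
have [s0|s0] := posnP s.
  have PE : P_in_m_poly = binomial_in_m n.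
    by rewrite /P_in_m_poly /fat_hilbert_in_m s0 mul0r subr0.
  rewrite PE; apply: lead; first by case: bideg_binomial_in_m.
  by rewrite coef_binomial_in_m scaler_eq0 (negbTE n0) monic_neq0 ?monicXn.
have rn := dim_disjoint_subspaces s0.
have [en|ne] := eqVneq r n.
  by rewrite /P_in_m_poly fat_hilbert_full // subrr lead_coef0 coef0.
have [sG cG] := bideg_fat_hilbert_in_m s rn.
apply: lead.
  apply: leq_trans (size_polyD _ _) _; rewrite size_polyN geq_max sG andbT.
  by case: bideg_binomial_in_m.
(* Compare coefficients of [t^n]: the binomial part gives the inverse of [n!], while the other part
   has degree at most [r < n] in [t]. *)
apply/eqP => /(congr1 (fun p : {poly rat} => p`_n)).
rewrite coefB coef_binomial_in_m coefB coefZ coefXn eqxx mulr1 coef0.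
rewrite [X in _ - X]nth_default ?subr0; first by move/eqP; rewrite (negbTE n0).
by apply: leq_trans (cG n) _; rewrite ltn_neqAle ne.
Qed.

End Configuration.

(** * The value of [Lambda] and the limit *)

Section Leading.
Variables (K : closedFieldType) (n r s : nat).
Hypothesis charK : [pchar K] =i pred0.
Variable V : 'I_s -> {vspace 'rV[K]_n.+1}.
Hypothesis hV : disjoint_subspaces r V.

(** The given configuration [V] makes the value chosen by [xget] unique: two polynomials satisfying
    [P_in_m] agree at all positive [m], hence coincide. *)
Lemma LambdaE : Lambda K n r s = (P_in_m_poly n r s)`_n.
Proof.
rewrite -(lead_coef_P_in_m hV) /Lambda.
have exL : is_Lambda K n r s (lead_coef (P_in_m_poly n r s)).
  by move=> W hW; exists (P_in_m_poly n r s) => //; apply: P_in_m_polyP.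
have [Q hQ <-] := xgetPex 0 (ex_intro _ _ exL : exists l, is_Lambda K n r s l) V hV.
congr lead_coef; apply: (@poly_eq_nat _ _ _ 1 natr_poly_rat_inj) => m m0.
by rewrite hQ // (P_in_m_polyP charK hV).
Qed.

Lemma cvg_aHP_seq (R : realType) (t : R) :
  aHP_seq (subspaces_ideal V) t @ \oo -->
    (map_poly ratr (fat_hilbert_in_m n r s)`_n).[t].
Proof.
(* Evaluating the inner variable at the real [t] leaves a real polynomial in [m], to which
   [cvg_lead_coef] applies. *)
pose ev : {rmorphism {poly rat} -> R} :=
  (horner_eval t \o map_poly (@ratr R)).
pose p := map_poly ev (fat_hilbert_in_m n r s).
have sp : (size p <= n.+1)%N.
  apply: leq_trans (size_poly _ _) _.
  have [s0|s0] := posnP s; last first.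
    by case: (bideg_fat_hilbert_in_m s (dim_disjoint_subspaces hV s0)).
  by rewrite /fat_hilbert_in_m s0 mul0r size_poly0.
have -> : (map_poly ratr (fat_hilbert_in_m n r s)`_n).[t] = p`_n.
  by rewrite coef_map.
have := cvg_lead_coef sp; rewrite -cvg_shiftS -[X in _ -> X]cvg_shiftS.
apply: cvg_trans; apply: near_eq_cvg; near=> m => /=.
rewrite /aHP_seq (hilbert_poly_symbolic charK hV) //; congr (_ / _).
rewrite -(rmorph_nat ev) /p horner_map fat_hilbert_in_mE //= /horner_eval.
rewrite map_comp_poly horner_comp; congr _.[_].
rewrite map_polyZ map_polyX hornerZ hornerX /= ratr_nat.
by rewrite -[in LHS](rmorph_nat ev).
Unshelve. all: by end_near. Qed.

End Leading.

(** Convergence is asserted separately because [limn] also assigns a value to divergent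
    sequences. *)
Theorem theorem17 (K : closedFieldType) (charK : [pchar K] =i pred0)
    (n r s : nat) (V : 'I_s -> {vspace 'rV[K]_n.+1})
    (hV : disjoint_subspaces r V) (R : realType) (t : R) :
  cvgn (aHP_seq (subspaces_ideal V) t) /\
  aHP (subspaces_ideal V) t
    = t ^+ n / n`!%:R - (map_poly ratr (Lambda K n r s)).[t].
Proof.
have aHPt := @cvg_aHP_seq K n r s charK V hV R t.
split; first exact: cvgP aHPt.
rewrite /aHP (cvg_lim _ aHPt) // (LambdaE charK hV) coefB coef_binomial_in_m.
rewrite rmorphB /= map_polyZ map_polyXn hornerD hornerN hornerZ hornerXn.
by rewrite fmorphV /= ratr_nat mulrC opprB addrC subrK.
Qed.
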